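(* Let $\phi_1,\dots,\phi_n:\mathbb{R}^m\to\mathbb{R}$ be convex, differentiable with $(1/\gamma)$-Lipschitz gradients ($\gamma>0$), let $g:\mathbb{R}^d\to\mathbb{R}$ be $1$-strongly convex, $\lambda>0$, and let $A_1,\dots,A_n\in\mathbb{R}^{d\times m}$ be nonzero. Let $X_1,\dots,X_\tau$ be a partition of $[n]$ into nonempty sets satisfying the group separability assumption: for every $j\in[d]$, there are no $i\in X_k$, $i'\in X_l$ with $k\ne l$ such that the $j$-th row of $A_i$ and the $j$-th row of $A_{i'}$ are both nonzero. For $i\in[n]$ let $l_i\in[\tau]$ be the index with $i\in X_{l_i}$. Suppose the algorithm Quartz (described in the context) is run with $\hat S$ the product sampling associated with $X_1,\dots,X_\tau$ and with $v_i=\lambda_{\max}(A_i^\top A_i)$ for all $i\in[n]$. If $0<\epsilon\le P(w^0)-D(\alpha^0)$ and the integer $T$ satisfies $$T\ge\max_{i\in[n]}\left(|X_{l_i}|+\frac{\lambda_{\max}(A_i^\top A_i)\,|X_{l_i}|}{\lambda\gamma n}\right)\log\left(\frac{P(w^0)-D(\alpha^0)}{\epsilon}\right),$$ then $\mathbb{E}[P(w^T)-D(\alpha^T)]\le\epsilon$.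
   Context: $[n]=\{1,\dots,n\}$; $\|\cdot\|$ is the Euclidean norm. The product sampling associated with a partition $X_1,\dots,X_\tau$ of $[n]$ is the random set $\hat S=\{i_1,\dots,i_\tau\}$ where $(i_1,\dots,i_\tau)$ is uniformly distributed on $X_1\times\cdots\times X_\tau$; hence $p_i=\mathbb{P}(i\in\hat S)=1/|X_{l_i}|$. $g$ is $1$-strongly convex means $g(w)\ge g(w')+\langle s,w-w'\rangle+\tfrac12\|w-w'\|^2$ for all $w,w'$ and every subgradient $s$ of $g$ at $w'$. $\xi^*(u)=\sup_s\{\langle s,u\rangle-\xi(s)\}$ is the convex (Fenchel) conjugate (possibly $+\infty$ for $\phi_i^*$; $g^*$ is finite and $1$-smooth). The primal and dual objectives are $$P(w)=\frac1n\sum_{i=1}^n\phi_i(A_i^\top w)+\lambda g(w),\quad w\in\mathbb{R}^d,$$ $$D(\alpha)=-\lambda g^*\Big(\frac1{\lambda n}\sum_{i=1}^nA_i\alpha_i\Big)-\frac1n\sum_{i=1}^n\phi_i^*(-\alpha_i),\quad \alpha=(\alpha_1,\dots,\alpha_n)\in(\mathbb{R}^m)^n.$$ Algorithm Quartz (with random set $\hat S\subseteq[n]$, $p_i=\mathbb{P}(i\in\hat S)>0$, and positive vector $v\in\mathbb{R}^n$): choose $\alpha^0\in(\mathbb{R}^m)^n$, $w^0\in\mathbb{R}^d$ (deterministic); set $\theta=\min_i\frac{p_i\lambda\gamma n}{v_i+\lambda\gamma n}$ and $\bar\alpha^0=\frac1{\lambda n}\sum_iA_i\alpha_i^0$. For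 $t=1,2,\dots$: (1) $w^t=(1-\theta)w^{t-1}+\theta\nabla g^*(\bar\alpha^{t-1})$; (2) draw a random set $S_t\subseteq[n]$ with the distribution of $\hat S$, independently of all previous draws; (3) for $i\notin S_t$ put $\alpha_i^t=\alpha_i^{t-1}$; for $i\in S_t$ put $\alpha_i^t=\alpha_i^{t-1}+\Delta\alpha_i^t$, where $\Delta\alpha_i^t$ is given by one of the two options (the result holds for either option): Option I: $\Delta\alpha_i^t=\arg\max_{\Delta\in\mathbb{R}^m}\big[-\phi_i^*(-(\alpha_i^{t-1}+\Delta))-\nabla g^*(\bar\alpha^{t-1})^\top A_i\Delta-\frac{v_i\|\Delta\|^2}{2\lambda n}\big]$; Option II: $\Delta\alpha_i^t=-\theta p_i^{-1}\alpha_i^{t-1}-\theta p_i^{-1}\nabla\phi_i(A_i^\top w^t)$; (4) $\bar\alpha^t=\bar\alpha^{t-1}+\frac1{\lambda n}\sum_{i\in S_t}A_i\Delta\alpha_i^t$ (so $\bar\alpha^t=\frac1{\lambda n}\sum_iA_i\alpha_i^t$). *)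

(* Defs.v *)
(* MathComp-Analysis development. *)
From HB Require Import structures.
From mathcomp Require Import all_boot all_order all_algebra.
From mathcomp Require Import all_classical all_reals all_analysis.

Set Implicit Arguments.
Unset Strict Implicit.
Unset Printing Implicit Defensive.

Import Order.TTheory GRing.Theory Num.Theory.
Import numFieldNormedType.Exports.

Local Open Scope classical_set_scope.
Local Open Scope ring_scope.

Section euclidean.
Context {R : realType} {k : nat}.
Implicit Types (u x y : 'cV[R]_k) (f : 'cV[R]_k -> R).

Definition dot u x : R := \sum_j u j ord0 * x j ord0.

(* The library norm on matrices is the sup norm, hence this one. *)
Definition enorm u : R := Num.sqrt (dot u u).

(* This is the gradient at points where f is differentiable. *)
Definition gradient f x : 'cV[R]_k := \col_j 'D_(delta_mx j ord0) f x.

Definition gradient_lipschitz (L : R) f : Prop :=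
  forall x y, enorm (gradient f x - gradient f y) <= L * enorm (x - y).

Definition is_convex f : Prop :=
  convex_function [set: convex_lmodType 'cV[R]_k] f.

Definition is_subgradient f x (s : 'cV[R]_k) : Prop :=
  forall y, f x + dot s (y - x) <= f y.

(* Convexity is not redundant: a function without subgradients satisfies
   the inequality vacuously. *)
Definition strongly_convex1 f : Prop :=
  is_convex f /\
  forall x y s, is_subgradient f y s ->
    f x >= f y + dot s (x - y) + 2^-1 * enorm (x - y) ^+ 2.

Definition conjugate f u : \bar R :=
  ereal_sup (range (fun s => (dot s u - f s)%:E)).

(* Gradient of the conjugate of f, for f whose conjugate is finite. *)
Definition conjugate_gradient f u : 'cV[R]_k :=
  gradient (fun x => fine (conjugate f x)) u.

End euclidean.

(* For symmetric M of positive size the set of eigenvalues is finite and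
   nonempty, so that this supremum is a maximum. *)
Definition lambda_max {R : realType} {k : nat} (M : 'M[R]_k) : R :=
  sup [set a | eigenvalue M a].

Section sampling.
Context {R : realType} {n : nat}.

Definition is_partition (tau : nat) (X : 'I_tau -> {set 'I_n}) : Prop :=
  [/\ forall k, X k != finset.set0,
      forall k l, k != l -> (X k :&: X l = finset.set0)%SET &
      forall i, exists k, i \in X k].

(* The probability that the set of coordinates of a uniform element of
   X_1 x ... x X_tau equals B. *)
Definition product_sampling (tau : nat) (X : 'I_tau -> {set 'I_n})
    (B : {set 'I_n}) : R :=
  #|[set f : {ffun 'I_tau -> 'I_n} |
      (f \in family X) && ([set f k | k : 'I_tau] == B)]%SET|%:R
  / #|(family X : simpl_pred {ffun 'I_tau -> 'I_n})|%:R.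

(* P(i \in S) for a random set S with probability mass function law. *)
Definition inclusion_prob (law : {set 'I_n} -> R) (i : 'I_n) : R :=
  \sum_(B : {set 'I_n} | i \in B) law B.

(* S t, for t >= 1, are random sets with mass function law, each of them
   independent of the previous ones; S 0 is irrelevant. *)
Definition iid_draws (dsp : measure_display) (Omega : measurableType dsp)
    (Pr : probability Omega R) (law : {set 'I_n} -> R)
    (S : nat -> Omega -> {set 'I_n}) : Prop :=
  [/\ forall t B, (0 < t)%N -> measurable [set o | S t o = B],
      forall t B, (0 < t)%N -> Pr [set o | S t o = B] = (law B)%:E &
      forall t (B : nat -> {set 'I_n}), (0 < t)%N ->
        let past := [set o | forall s, (0 < s < t)%N -> S s o = B s] in
        Pr ([set o | S t o = B t] `&` past) =
        (Pr [set o | S t o = B t] * Pr past)%E].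

End sampling.

Definition group_separable {R : realType} (n m d tau : nat)
    (A : 'I_n -> 'M[R]_(d, m)) (X : 'I_tau -> {set 'I_n}) : Prop :=
  forall j : 'I_d, ~ exists k l i i',
    [/\ k != l, i \in X k, i' \in X l, row j (A i) != 0 & row j (A i') != 0].

Inductive quartz_option : Set := OptionI | OptionII.

Section quartz.
Context {R : realType} {n m d : nat}.
Variables (phi : 'I_n -> 'cV[R]_m -> R) (g : 'cV[R]_d -> R).
Variables (A : 'I_n -> 'M[R]_(d, m)) (lam gam : R).

Definition primal (w : 'cV[R]_d) : R :=
  n%:R^-1 * \sum_i phi i ((A i)^T *m w) + lam * g w.

Definition dual_average (alpha : 'I_n -> 'cV[R]_m) : 'cV[R]_d :=
  (lam * n%:R)^-1 *: \sum_i A i *m alpha i.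

(* Valued in \bar R: it is -oo as soon as one phi_i^* is +oo. *)
Definition dual (alpha : 'I_n -> 'cV[R]_m) : \bar R :=
  (- (lam%:E * conjugate g (dual_average alpha))
   - (n%:R^-1)%:E * \sum_(i < n) conjugate (phi i) (- alpha i))%E.

Definition duality_gap (w : 'cV[R]_d) (alpha : 'I_n -> 'cV[R]_m) : \bar R :=
  ((primal w)%:E - dual alpha)%E.

Variables (p v : 'I_n -> R).

(* A minimum, as n > 0. *)
Definition quartz_theta : R :=
  inf (range (fun i => p i * lam * gam * n%:R / (v i + lam * gam * n%:R))).

Definition option1_objective (i : 'I_n) (a : 'cV[R]_m) (abar : 'cV[R]_d)
    (Delta : 'cV[R]_m) : \bar R :=
  (- conjugate (phi i) (- (a + Delta))
   - (dot (conjugate_gradient g abar) (A i *m Delta))%:E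
   - (v i * enorm Delta ^+ 2 / (2 * lam * n%:R))%:E)%E.

(* a and abar are the values before the update, w is the one after it. *)
Definition quartz_increment (opt : quartz_option) (i : 'I_n)
    (a : 'cV[R]_m) (abar w : 'cV[R]_d) (Delta : 'cV[R]_m) : Prop :=
  match opt with
  | OptionI => forall Delta',
      (option1_objective i a abar Delta'
       <= option1_objective i a abar Delta)%E
  | OptionII =>
      Delta = - (quartz_theta / p i) *: a
              - (quartz_theta / p i) *: gradient (phi i) ((A i)^T *m w)
  end.

(* One trajectory, for the realization S 1, S 2, ... of the random sets. *)
Record quartz_run (opt : quartz_option)
    (w0 : 'cV[R]_d) (alpha0 : 'I_n -> 'cV[R]_m) (S : nat -> {set 'I_n})
    (w : nat -> 'cV[R]_d) (alpha : nat -> 'I_n -> 'cV[R]_m)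
    (abar : nat -> 'cV[R]_d) : Prop := {
  quartz_w0 : w 0%N = w0;
  quartz_alpha0 : alpha 0%N = alpha0;
  quartz_abar0 : abar 0%N = dual_average alpha0;
  quartz_w : forall t, w t.+1 =
    (1 - quartz_theta) *: w t + quartz_theta *: conjugate_gradient g (abar t);
  quartz_step : forall t, exists Delta : 'I_n -> 'cV[R]_m,
    [/\ forall i, i \in S t.+1 ->
          quartz_increment opt i (alpha t i) (abar t) (w t.+1) (Delta i),
        forall i, alpha t.+1 i =
          if i \in S t.+1 then alpha t i + Delta i else alpha t i &
        abar t.+1 = abar t +
          (lam * n%:R)^-1 *: \sum_(i in S t.+1) A i *m Delta i]
}.

End quartz.

(* Main.v *)
(* Group separability makes the blocks A_i h_i of a sampled set orthogonal, so
   the expected separable overapproximation holds surely with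
   v_i = lambda_max (A_i^T A_i). Since g is 1-strongly convex, g^* is finite and
   1-smooth with the maximizer of <s, u> - g s as gradient; since phi_i is
   1/gam-smooth, phi_i^* is gam-strongly convex. With
   q = theta / p_i <= lam gam n / (v_i + lam gam n), strong convexity absorbs
   the quadratic term produced by smoothness, and one iteration contracts the
   conditional expectation of the gap by 1 - theta. The increments of Option I
   are unique by strict concavity, so the iterates are functions of the finitely
   valued history of draws and all expectations are finite sums. Finally
   1 / theta is the constant in the bound on T, and
   (1 - theta)^T <= exp (- theta T). *)
Require Import Defs.
From mathcomp Require Import all_boot all_order all_algebra.
From mathcomp Require Import all_classical all_reals all_analysis.
From mathcomp Require Import ring lra.

Set Implicit Arguments.
Unset Strict Implicit.
Unset Printing Implicit Defensive.

Import Order.TTheory GRing.Theory Num.Theory.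
Import numFieldNormedType.Exports.

Local Open Scope classical_set_scope.
Local Open Scope ring_scope.

(** * Convex analysis in Euclidean space *)

Section dot_theory.
Context {R : realType} {k : nat}.
Implicit Types (u x y z : 'cV[R]_k) (c : R).

Lemma dotC x y : dot x y = dot y x.
Proof. by apply: eq_bigr => j _; rewrite mulrC. Qed.

Lemma dotDr x y z : dot x (y + z) = dot x y + dot x z.
Proof. by rewrite -big_split; apply: eq_bigr => j _; rewrite mxE mulrDr. Qed.

Lemma dotZr c x y : dot x (c *: y) = c * dot x y.
Proof. by rewrite big_distrr; apply: eq_bigr => j _; rewrite mxE mulrCA. Qed.

Lemma dotDl x y z : dot (y + z) x = dot y x + dot z x.
Proof. by rewrite -!(dotC x) dotDr. Qed.

Lemma dotZl c x y : dot (c *: x) y = c * dot x y.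
Proof. by rewrite -!(dotC y) dotZr. Qed.

Lemma dotNr x y : dot x (- y) = - dot x y.
Proof. by rewrite -scaleN1r dotZr mulN1r. Qed.

Lemma dotNl x y : dot (- x) y = - dot x y.
Proof. by rewrite dotC dotNr dotC. Qed.

Lemma dot0r x : dot x 0 = 0.
Proof. by rewrite -(scale0r 0) dotZr mul0r. Qed.

Definition dotE := (dotDl, dotDr, dotNl, dotNr, dotZl, dotZr).

Lemma dot_sumr (I : finType) (P : pred I) (F : I -> 'cV[R]_k) x :
  dot x (\sum_(i | P i) F i) = \sum_(i | P i) dot x (F i).
Proof. by apply: (big_morph (dot x) (dotDr x) (dot0r x)). Qed.

Lemma dot_ge0 x : 0 <= dot x x.
Proof. by apply: sumr_ge0 => j _; rewrite -expr2 sqr_ge0. Qed.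

Lemma sqr_coord_le x j : x j ord0 ^+ 2 <= dot x x.
Proof.
rewrite /dot (bigD1 j) //= expr2 lerDl.
by apply: sumr_ge0 => i _; rewrite -expr2 sqr_ge0.
Qed.

Lemma dot_eq0 x : dot x x = 0 -> x = 0.
Proof.
move=> x0; apply/matrixP => j i; rewrite ord1 mxE; apply/eqP.
by rewrite -sqrf_eq0 eq_le sqr_ge0 -x0 sqr_coord_le.
Qed.

Lemma enorm_sqr x : enorm x ^+ 2 = dot x x.
Proof. by rewrite sqr_sqrtr // dot_ge0. Qed.

Lemma enorm_ge0 x : 0 <= enorm x.
Proof. exact: sqrtr_ge0. Qed.

Lemma enormZ c x : enorm (c *: x) = `|c| * enorm x.
Proof.
by rewrite /enorm dotZl dotZr mulrA sqrtrM -expr2 ?sqr_ge0 // sqrtr_sqr.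
Qed.

(** Cauchy-Schwarz: expand the squared norm of [dot x x *: y - dot x y *: x], which is
    nonnegative. *)
Lemma dot_le_enorm x y : dot x y <= enorm x * enorm y.
Proof.
have [->|x0] := eqVneq x 0.
  by rewrite dotC dot0r mulr_ge0 ?enorm_ge0.
have dx : 0 < dot x x.
  by rewrite lt_def dot_ge0 andbT; apply: contra_neq x0 => /dot_eq0.
rewrite /enorm -sqrtrM ?dot_ge0 // (le_trans (ler_norm _)) //.
rewrite -sqrtr_sqr ler_sqrt ?mulr_ge0 ?dot_ge0 //.
have := dot_ge0 (dot x x *: y - dot x y *: x).
have -> : dot (dot x x *: y - dot x y *: x) (dot x x *: y - dot x y *: x) =
    dot x x * (dot x x * dot y y - dot x y ^+ 2).
  by rewrite !dotE (dotC y x); ring.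
by rewrite pmulr_rge0 // subr_ge0.
Qed.

Lemma dot_delta x j : dot x (delta_mx j ord0) = x j ord0.
Proof.
rewrite /dot (bigD1 j) //= mxE !eqxx mulr1 big1 ?addr0 // => i ij.
by rewrite mxE (negPf ij) mulr0.
Qed.

Lemma col_delta x : x = \sum_j x j ord0 *: delta_mx j ord0.
Proof.
by rewrite {1}[x]matrix_sum_delta; apply: eq_bigr => j _; rewrite big_ord1.
Qed.

End dot_theory.

Lemma dot_mulmx {R : realType} {a b : nat} (M : 'M[R]_(a, b)) x y :
  dot (M^T *m x) y = dot x (M *m y).
Proof.
rewrite /dot; under eq_bigr do rewrite mxE big_distrl /=.
rewrite exchange_big; apply: eq_bigr => i _.
by rewrite mxE big_distrr; apply: eq_bigr => j _; rewrite mxE /=; ring.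
Qed.

(** * Existence of subgradients for finite convex functions *)

Section subgradient.
Context {R : realType} {k : nat}.
Implicit Types (f : 'cV[R]_k -> R) (x y s : 'cV[R]_k).

Lemma is_convex_le f (t : R) x y : is_convex f -> 0 <= t <= 1 ->
  f (t *: x + (1 - t) *: y) <= t * f x + (1 - t) * f y.
Proof.
move=> cf t01; have := cf (Itv01 (andP t01).1 (andP t01).2) x y.
by rewrite !inE => /(_ I I).
Qed.

(* Dominated extension of the linear form, one coordinate at a time. *)
Lemma subgradient_exists f x : is_convex f -> exists s, is_subgradient f x s.
Proof.
move=> cf.
suff H (j : nat) : (j <= k)%N -> exists s, forall h : 'cV[R]_k,
    (forall i : 'I_k, (j <= i)%N -> h i ord0 = 0) -> f x + dot s h <= f (x + h).
  have [s hs] := H k (leqnn _); exists s => y.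
  rewrite -{2}(subrKC x y); apply: hs => i; rewrite leqNgt ltn_ord //.
elim: j => [_|j IH jk].
  exists 0 => h h0; suff -> : h = 0 by rewrite dot0r !addr0.
  by apply/matrixP => a b; rewrite ord1 h0 ?mxE.
have [s hs] := IH (ltnW jk).
pose J := Ordinal jk; pose e : 'cV[R]_k := delta_mx J ord0.
pose V (h : 'cV[R]_k) := forall i : 'I_k, (j <= i)%N -> h i ord0 = 0.
(* Backward slopes along [e]. By [key] they lie below all forward slopes, so their supremum is an
   admissible value of the extended form on [e]. *)
pose L := [set c | exists h r, [/\ V h, 0 < r &
   c = (f x + dot s h - f (x + h - r *: e)) / r]].
have key h r h' t : V h -> V h' -> 0 < r -> 0 < t ->
    (f x + dot s h - f (x + h - r *: e)) / r <=
    (f (x + h' + t *: e) - (f x + dot s h')) / t.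
  move=> Vh Vh' r0 t0; rewrite ler_pdivrMr // mulrAC ler_pdivlMr //.
  have rt0 : r + t != 0 by rewrite gt_eqF // addr_gt0.
  (* With this weight the [e] components of the two points cancel, and the convex combination falls
     where the induction hypothesis [hs] applies. *)
  pose q := t / (r + t).
  have q01 : 0 <= q <= 1.
    apply/andP; split; first by rewrite divr_ge0 ?addr_ge0 ?ltW.
    by rewrite ler_pdivrMr ?addr_gt0 // mul1r lerDr ltW.
  have := is_convex_le (x + h - r *: e) (x + h' + t *: e) cf q01.
  have q1 : 1 - q = r / (r + t) by rewrite /q; field.
  have -> : q *: (x + h - r *: e) + (1 - q) *: (x + h' + t *: e) =
     x + (q *: h + (1 - q) *: h').
    apply/matrixP => a b; rewrite q1 /q !mxE; field; exact: rt0.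
  have /hs : V (q *: h + (1 - q) *: h').
    by move=> i ji; rewrite !mxE Vh // Vh' // !mulr0 addr0.
  move=> h1 h2; have {h1 h2} := le_trans h1 h2.
  rewrite !dotE q1 /q -(ler_pM2l (addr_gt0 r0 t0)).
  set F1 := f _; set F2 := f (_ + _ - _); set F3 := f _.
  have -> : (r + t) * (F1 + (t / (r + t) * dot s h + r / (r + t) * dot s h')) =
     (r + t) * F1 + t * dot s h + r * dot s h' by field.
  have -> : (r + t) * (t / (r + t) * F2 + r / (r + t) * F3) = t * F2 + r * F3
    by field.
  by lra.
have V0 : V 0 by move=> i _; rewrite mxE.
have Lne : L !=set0 by exists ((f x + dot s 0 - f (x + 0 - 1 *: e)) / 1), 0, 1.
have Lub : has_ubound L.
  exists ((f (x + 0 + 1 *: e) - (f x + dot s 0)) / 1) => _ [h [r [Vh r0 ->]]].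
  exact: key.
pose c := sup L.
pose h0 (h : 'cV[R]_k) : 'cV[R]_k := h - h J ord0 *: e.
exists (s + (c - s J ord0) *: e) => h Vh.
have Vh0 : V (h0 h).
  move=> i; rewrite !mxE leq_eqVlt => /orP[/eqP ji|ji].
    have -> : i = J by apply/val_inj.
    by rewrite !eqxx mulr1 subrr.
  have iJ : (i == J) = false by apply/negbTE; rewrite -val_eqE /= gtn_eqF.
  by rewrite (Vh i ji) iJ mulr0 subrr.
have -> : dot (s + (c - s J ord0) *: e) h = dot s (h0 h) + c * h J ord0.
  by rewrite /h0 !dotE (dotC e) dot_delta dot_delta; ring.
have hE : x + h = x + h0 h + h J ord0 *: e by rewrite -addrA subrK.
(* For a negative coordinate [c] dominates the backward slopes; for a positive one it is dominated
   by the forward slopes. *)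
have [r0|r0|r0] := ltgtP (h J ord0) 0.
- have Lx : L ((f x + dot s (h0 h) - f (x + h0 h - (- h J ord0) *: e)) /
             - h J ord0).
    by exists (h0 h), (- h J ord0); rewrite oppr_gt0.
  have : (f x + dot s (h0 h) - f (x + h0 h - (- h J ord0) *: e)) / - h J ord0
      <= c by exact: ub_le_sup Lub _ Lx.
  by rewrite ler_pdivrMr ?oppr_gt0 // scaleNr opprK -hE; lra.
- have : c <= (f (x + h0 h + h J ord0 *: e) - (f x + dot s (h0 h))) / h J ord0.
    by apply: ge_sup => // _ [h' [r [Vh' r' ->]]]; exact: key.
  by rewrite ler_pdivlMr // -hE; lra.
- by rewrite r0 mulr0 addr0 hE r0 scale0r addr0; exact: hs.
Qed.

End subgradient.

(** * Compactness, attained minima and identification of gradients *)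

Section cV_topology.
Context {R : realType} {k : nat}.
Implicit Types (x y z s u : 'cV[R]_k) (f g : 'cV[R]_k -> R).

(** A box of row vectors is a product of segments, and transposition is continuous. *)
Lemma compact_box (M : R) :
  compact [set x : 'cV[R]_k | forall j, x j ord0 \in `[- M, M]].
Proof.
have -> : [set x : 'cV[R]_k | forall j, x j ord0 \in `[- M, M]] =
    trmx @` [set x : 'rV[R]_k | forall j, `[- M, M]%classic (x ord0 j)].
  apply/seteqP; split=> [x xM|_ [x xM <-] j]; last by rewrite mxE; exact: xM.
  by exists x^T; [move=> j; rewrite mxE; exact: xM|rewrite trmxK].
apply: continuous_compact; last first.
  apply: (@rV_compact R k (fun=> `[- M, M]%classic)) => _.
  exact: segment_compact.
apply: continuous_subspaceT => x U /nbhs_ballP[e e0 eU].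
apply/nbhs_ballP; exists e => //= y [_ xy]; apply: eU; split=> // i j.
by rewrite !mxE; exact: xy.
Qed.

Lemma continuous_coord j : continuous (fun x => x j ord0).
Proof. exact: coord_continuous. Qed.

Lemma continuous_dot {T : topologicalType} (F G : T -> 'cV[R]_k) :
  (forall j, continuous (fun t => F t j ord0)) ->
  (forall j, continuous (fun t => G t j ord0)) ->
  continuous (fun t => dot (F t) (G t)).
Proof.
move=> cF cG; rewrite /dot.
apply: continuous_big => [|j _ t]; first exact: add_continuous.
by apply: cvgM; [exact: cF|exact: cG].
Qed.

Lemma continuous_dotr s : continuous (dot s).
Proof.
apply: (@continuous_dot _ (fun=> s) id) => j; last exact: continuous_coord.
exact: cst_continuous.
Qed.

Lemma continuous_quadratic (M : 'M[R]_k) : continuous (fun x => dot x (M *m x)).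
Proof.
apply: (@continuous_dot _ id (mulmx M)) => j; first exact: continuous_coord.
have -> : (fun x => (M *m x) j ord0) = dot (row j M)^T.
  by apply/funext => x; rewrite mxE; apply: eq_bigr => i _; rewrite !mxE.
exact: continuous_dotr.
Qed.

(* A minimizing sequence is bounded; at a cluster point the subgradient
   provides the lower semicontinuity. *)
Lemma strongly_convex1_subgradient g u : strongly_convex1 g ->
  exists z, is_subgradient g z u.
Proof.
move=> [cg sg]; pose f x := g x - dot u x.
have [s0 hs0] := subgradient_exists 0 cg.
pose b := s0 - u.
have fge x : f 0 + dot b x + 2^-1 * dot x x <= f x.
  have := sg x _ _ hs0; rewrite enorm_sqr subr0 /f /b !dotE dot0r; lra.
clearbody b => {hs0}.
(* Completing the square in the quadratic minorant [fge]. *)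
have lbf : lbound (range f) (f 0 - 2^-1 * dot b b).
  move=> _ [x _ <-]; have := fge x.
  by have := dot_ge0 (x + b); rewrite !dotE (dotC x b); lra.
have inff : has_inf (range f).
  by split; [exists (f 0), 0|exists (f 0 - 2^-1 * dot b b)].
set mu := inf (range f).
have muf x : mu <= f x by apply: ge_inf; [exact: inff.2|exists x].
have /choice[v vP] n : exists x, f x < mu + n.+1%:R^-1.
  have [_ [x _ <-] ?] : exists2 e, range f e & e < mu + n.+1%:R^-1.
    by apply: inf_adherent => //; rewrite invr_gt0.
  by exists x.
(* From [f (v n) < mu + 1 <= f 0 + 1] and [fge], the squared norm of [v n + b] is at most
   [2 + dot b b]. A real whose square is at most [c] is at most [1 + c] in absolute value; the
   square root accounts for removing [b]. *)
pose M := 1 + (2 + dot b b) + Num.sqrt (dot b b).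
have vM n j : v n j ord0 \in `[- M, M].
  have : dot (v n + b) (v n + b) <= dot b b + 2.
    have := fge (v n); have := vP n; have := muf 0.
    have : n.+1%:R^-1 <= 1 :> R by rewrite invf_le1 // ler1n.
    by rewrite !dotE (dotC (v n) b); move: (n.+1%:R^-1) => q; lra.
  move/(le_trans (sqr_coord_le (v n + b) j)); rewrite mxE.
  have : `|b j ord0| <= Num.sqrt (dot b b).
    by rewrite -sqrtr_sqr ler_sqrt ?dot_ge0 ?sqr_coord_le.
  have := dot_ge0 b.
  rewrite in_itv /= /M ler_norml => b0 /andP[b1 b2] h.
  have h1 : v n j ord0 + b j ord0 <= 3 + dot b b by nra.
  have h2 : - (3 + dot b b) <= v n j ord0 + b j ord0 by nra.
  by apply/andP; split; lra.
have [p [_ cp]] : [set x : 'cV[R]_k | forall j, x j ord0 \in `[- M, M]] `&`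
    cluster (v @ \oo) !=set0.
  by apply: (@compact_box M); exists 0%N => // n _ j; exact: vM.
exists p.
suff fp : f p <= mu.
  by move=> y; have := muf y; rewrite /f in fp *; rewrite !dotE; lra.
have [s hs] := subgradient_exists p cg.
apply/ler_addgt0Pr => e e0.
pose U := [set y | `|dot (s - u) p - dot (s - u) y| < e / 2].
have e20 : 0 < e / 2 by rewrite divr_gt0.
have Up : nbhs p U by have /cvgrPdist_lt := @continuous_dotr (s - u) p; exact.
pose W := [set y | f y < mu + e / 2].
have vW : \forall n \near \oo, f (v n) < mu + e / 2.
  near=> n; apply: (lt_trans (vP n)); rewrite ltrD2l.
  by near: n; exact: near_infty_natSinv_lt (PosNum e20).
have [y [/= yW yU]] := cp W U vW Up.
have := hs y; move: yW yU; rewrite /W /U /= ltr_norml /f !dotE => yW /andP[].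
by lra.
Unshelve. all: by end_near. Qed.

(** Divided by the increment, the quadratic remainder tends to 0, which gives the partial
    derivatives and hence [gradient] without establishing differentiability. *)
Lemma gradient_eq f x z (C : R) :
  (forall h, `|f (x + h) - f x - dot z h| <= C * dot h h) -> gradient f x = z.
Proof.
move=> fz; apply/matrixP => j i; rewrite ord1 mxE.
apply: cvg_lim => //; apply/cvgrPdist_le => e e0.
(* [C] may be zero or negative, so this is the denominator used to bound the increment. *)
have C0 : 0 < `|C| + 1 by rewrite ltr_wpDl.
near=> t; have t0 : t != 0 by near: t; exact: nbhs_dnbhs_neq.
have := fz (t *: delta_mx j ord0).
rewrite !dotE !dot_delta mxE !eqxx mulr1 /= (addrC _ x).
set F := f _ - f x => tz.
have -> : z j ord0 - t^-1 * F = - (t^-1 * (F - t * z j ord0)) by field.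
rewrite normrN normrM normfV -(ler_pM2l (_ : 0 < `|t|)) ?normr_gt0 //.
rewrite mulVKf ?normr_eq0 // (le_trans tz) // -expr2 -real_normK ?num_real //.
rewrite expr2 mulrCA ler_wpM2l //.
have : `|t| <= e / (`|C| + 1).
  by near: t; apply: dnbhs0_le; rewrite divr_gt0.
rewrite ler_pdivlMr // => te; apply: le_trans te.
by rewrite mulrC ler_wpM2l // (le_trans (ler_norm _)) // lerDl.
Unshelve. all: by end_near. Qed.

End cV_topology.

(** * Fenchel conjugates of strongly convex and of smooth functions *)

Section conjugate.
Context {R : realType} {k : nat}.
Implicit Types (f g : 'cV[R]_k -> R) (x y z s u h : 'cV[R]_k).

Lemma conjugate_ge f u s : ((dot s u - f s)%:E <= conjugate f u)%E.
Proof. by apply: ereal_sup_ubound; exists s. Qed.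

Lemma conjugate_le f u (c : R) :
  (forall s, dot s u - f s <= c) -> (conjugate f u <= c%:E)%E.
Proof. by move=> fc; apply: ge_ereal_sup => _ [s _ <-]; rewrite lee_fin. Qed.

Lemma conjugate_gtNy f u : (-oo < conjugate f u)%E.
Proof. by apply: lt_le_trans (conjugate_ge f u 0); rewrite ltNyr. Qed.

Lemma conjugate_fin_num f u (c : R) :
  (conjugate f u <= c%:E)%E -> conjugate f u \is a fin_num.
Proof.
by move=> fc; rewrite fin_real // conjugate_gtNy (le_lt_trans fc) ?ltry.
Qed.

Lemma fine_conjugate_ge f u s : conjugate f u \is a fin_num ->
  dot s u - f s <= fine (conjugate f u).
Proof. by move=> fin; rewrite -lee_fin fineK // conjugate_ge. Qed.

(** Equality case of Fenchel-Young: the subgradient inequality says that [x] maximizes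
    [dot y s - f y]. *)
Lemma conjugate_subgradient f x s :
  is_subgradient f x s -> conjugate f s = (dot x s - f x)%:E.
Proof.
move=> fs; apply/eqP; rewrite eq_le conjugate_ge andbT.
by apply: conjugate_le => y; have := fs y; rewrite !dotE !(dotC s); lra.
Qed.

(** A point [z] with subgradient [u] attains the conjugate at [u]. Testing the conjugate at [u + h]
    with [z] gives a linear lower bound, and strong convexity at [z] gives an upper bound with a
    quadratic error, so [gradient_eq] identifies [z]. *)
Lemma conjugate_gradient_subgradient g u : strongly_convex1 g ->
  is_subgradient g (conjugate_gradient g u) u.
Proof.
move=> sg; have [z gz] := strongly_convex1_subgradient u sg.
suff -> : conjugate_gradient g u = z by [].
apply: (@gradient_eq _ _ _ _ _ 1) => h.
rewrite (conjugate_subgradient gz) /=.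
have [z' gz'] := strongly_convex1_subgradient (u + h) sg.
have := conjugate_ge g (u + h) z; rewrite (conjugate_subgradient gz').
have := sg.2 z' z u gz; have := dot_ge0 (z' - z - h); have := dot_ge0 h.
rewrite lee_fin ler_norml enorm_sqr /= !dotE !(dotC u) !(dotC h) !(dotC z' z).
by move=> h1 h2 h3 h4; apply/andP; split; lra.
Qed.

Lemma conjugate_eq g u : strongly_convex1 g ->
  conjugate g u = (dot (conjugate_gradient g u) u
                   - g (conjugate_gradient g u))%:E.
Proof.
move=> sg.
exact: conjugate_subgradient (conjugate_gradient_subgradient u sg).
Qed.

(** Strong convexity at the maximizer [z] bounds the remainder by [dot (z' - z) h - 2^-1 * dot (z' -
    z) (z' - z)], which is at most [2^-1 * dot h h]. *)
Lemma conjugate_smooth g u h : strongly_convex1 g ->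
  fine (conjugate g (u + h)) <=
  fine (conjugate g u) + dot (conjugate_gradient g u) h + 2^-1 * dot h h.
Proof.
move=> sg; have := conjugate_gradient_subgradient u sg.
rewrite !conjugate_eq //=.
set z := conjugate_gradient g u; set z' := conjugate_gradient g (u + h) => gz.
have := sg.2 z' z u gz; have := dot_ge0 (z' - z - h).
rewrite enorm_sqr /= !dotE !(dotC u) !(dotC h) !(dotC z' z); lra.
Qed.

Lemma derive_gradient f x h : differentiable f x ->
  'D_h f x = dot (gradient f x) h.
Proof.
move=> df; rewrite deriveE // {1}[h]col_delta linear_sum; apply: eq_bigr => j _.
by rewrite linearZ mxE deriveE // mulrC.
Qed.

(** Convexity bounds the difference quotients towards [y] by [f y - f x] for steps in []0, 1]]; pass
    to the right limit at 0. *)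
Lemma gradient_subgradient f x : is_convex f -> differentiable f x ->
  is_subgradient f x (gradient f x).
Proof.
move=> cf df y.
rewrite -derive_gradient // -lerBrDl.
have dv : derivable f x (y - x) by exact: diff_derivable.
have /cvg_lim <- // : t^-1 *: (f (t *: (y - x) + x) - f x) @[t --> 0^'+] -->
  'D_(y - x) f x by exact: cvg_dnbhs_at_right dv.
apply: limr_le; first by apply: cvgP; exact: cvg_dnbhs_at_right dv.
near=> t.
have t0 : 0 < t by [].
have t1 : t <= 1 by near: t; exact: nbhs_right_le.
have := is_convex_le y x (t := t) cf; rewrite t1 ltW // => /(_ isT).
have -> : t *: y + (1 - t) *: x = t *: (y - x) + x.
  by rewrite scalerBr scalerBl scale1r addrA addrAC.
by rewrite /GRing.scale /= ler_pdivrMl // => ft; lra.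
Unshelve. all: by end_near. Qed.

Section smooth.
Variables (gam : R) (f : 'cV[R]_k -> R).
Hypotheses (gam_gt0 : 0 < gam) (df : forall x, differentiable f x)
  (lf : gradient_lipschitz gam^-1 f).

(** Along the segment, [f] minus the claimed quadratic has a nonpositive derivative, by
    Cauchy-Schwarz and the Lipschitz bound; compare the endpoints. *)
Lemma descent x h :
  f (x + h) <= f x + dot (gradient f x) h + (2 * gam)^-1 * dot h h.
Proof.
pose psi (t : R) := f (x + t *: h).
have dpsi (t : R) :
    is_derive t 1 psi (dot (gradient f (x + t *: h)) h).
  rewrite -derive_gradient //.
  have : derivable f (x + t *: h) h by exact: diff_derivable.
  have E : (fun r : R => r^-1 *: ((psi \o shift t) (r *: 1) - psi t)) =
      (fun r => r^-1 *: ((f \o shift (x + t *: h)) (r *: h) - f (x + t *: h))).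
    apply/funext => r /=; rewrite /psi; congr (_ *: (f _ - _)).
    by rewrite scalerDl [r *: 1]mulr1 addrCA.
  by move=> dv; apply: DeriveDef; rewrite /derivable /derive E.
pose a := dot (gradient f x) h; pose b := (2 * gam)^-1 * dot h h.
pose F : R -> R := psi - a *: id - b *: (id ^+ 2).
have dF (t : R) : is_derive t 1 F
    (dot (gradient f (x + t *: h)) h - a - 2 * b * t).
  apply: is_derive_eq.
  by rewrite /GRing.scale /= expr1 !mulr1 -[in RHS]mulrA; congr (_ - _); ring.
have : F 1 <= F 0.
  apply: (@ler0_derive1_nincr _ F 0 1) => // [t|].
    rewrite in_itv /= => /andP[t0 _]; rewrite derive1E derive_val.
    have -> : dot (gradient f (x + t *: h)) h - a =
        dot (gradient f (x + t *: h) - gradient f x) h by rewrite !dotE.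
    rewrite subr_le0; apply: (le_trans (dot_le_enorm _ _)).
    have := lf (x + t *: h) x.
    have -> : x + t *: h - x = t *: h by rewrite addrC addKr.
    rewrite enormZ ger0_norm ?(ltW t0) //.
    move/(ler_wpM2r (enorm_ge0 h))/le_trans; apply.
    rewrite -!mulrA -expr2 enorm_sqr /b invfM le_eqVlt; apply/orP; left.
    by apply/eqP; field; rewrite gt_eqF.
  apply: derivable_within_continuous => t _; exact: ex_derive.
rewrite /F !fctE /psi scale1r scale0r addr0 -/a -/b; clearbody a b.
by rewrite /GRing.scale /=; lra.
Qed.

(* Testing [conjugate f u] at [x + gam *: (u - gradient f x)] shows that every
   affine minorant of the conjugate can be improved by a quadratic. *)
Lemma conjugate_ge_quadratic x u : conjugate f u \is a fin_num ->
  dot x u - f x + gam / 2 * dot (u - gradient f x) (u - gradient f x)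
  <= fine (conjugate f u).
Proof.
move=> fin; set G := gradient f x.
apply: le_trans (fine_conjugate_ge (x + gam *: (u - G)) fin).
have := descent x (gam *: (u - G)); rewrite -/G.
set D := dot (u - G) (u - G).
have -> : (2 * gam)^-1 * dot (gam *: (u - G)) (gam *: (u - G)) = gam / 2 * D.
  by rewrite dotZl dotZr -/D; field; rewrite gt_eqF.
have -> : dot (x + gam *: (u - G)) u =
    dot x u + dot G (gam *: (u - G)) + gam * D.
  by rewrite /D !dotE !(dotC u G); ring.
lra.
Qed.

(** For each test point [s] with gradient [G], average [conjugate_ge_quadratic] at [u] and [z]. The
    two squares sum to the square of [(1 - q) *: (u - G) + q *: (z - G)], which is dropped, plus
    [q * (1 - q)] times that of [u - z]. Stated in [\bar R], the bound also yields finiteness at the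
    intermediate point. *)
Lemma conjugate_strongly_convex u z (q : R) : 0 <= q <= 1 ->
  conjugate f u \is a fin_num -> conjugate f z \is a fin_num ->
  (conjugate f ((1 - q) *: u + q *: z) <=
   ((1 - q) * fine (conjugate f u) + q * fine (conjugate f z)
    - gam / 2 * (q * (1 - q)) * dot (u - z) (u - z))%:E)%E.
Proof.
move=> /andP[q0 q1] fu fz; apply: conjugate_le => s; set G := gradient f s.
have q1' : 0 <= 1 - q by rewrite subr_ge0.
have := ler_wpM2l q1' (conjugate_ge_quadratic s fu).
have := ler_wpM2l q0 (conjugate_ge_quadratic s fz); rewrite -/G.
have : 0 <= gam / 2 * dot ((1 - q) *: (u - G) + q *: (z - G))
                          ((1 - q) *: (u - G) + q *: (z - G)).
  by rewrite mulr_ge0 ?dot_ge0 // divr_ge0 // ltW.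
rewrite !dotE !(dotC G) !(dotC z u).
set Fu := fine _; set Fz := fine _.
set a1 := dot _ _; set a2 := dot _ _; set a3 := dot _ _.
move: (dot _ _) (dot _ _) (dot _ _) => a4 a5 a6.
nra.
Qed.

Lemma conjugate_gradientE x : is_convex f ->
  conjugate f (gradient f x) = (dot x (gradient f x) - f x)%:E.
Proof.
by move=> cf; exact: conjugate_subgradient (gradient_subgradient cf (@df x)).
Qed.

End smooth.
End conjugate.

(** * Largest eigenvalue of a Gram matrix *)

Section lambda_max.
Context {R : realType} {k : nat}.

(* A maximizer of the Rayleigh quotient over the unit sphere is an
   eigenvector. *)
Lemma rayleigh_max (M : 'M[R]_k) : (0 < k)%N -> M^T = M ->
  exists mu, eigenvalue M mu /\ forall h, dot h (M *m h) <= mu * dot h h.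
Proof.
move=> k0 symM.
pose sph := [set x : 'cV[R]_k | dot x x = 1].
have sph0 : sph !=set0.
  by exists (delta_mx (Ordinal k0) ord0); rewrite /sph /= dot_delta mxE !eqxx.
have csph : compact sph.
  apply: (subclosed_compact _ (@compact_box R k 1)).
    apply: (@closed_comp _ _ (fun x : 'cV[R]_k => dot x x) [set 1]).
      by move=> x _; apply: continuous_dot => j; exact: continuous_coord.
    exact: closed_eq.
  move=> x; rewrite /sph /= => x1 j; have := sqr_coord_le x j; rewrite x1.
  by rewrite in_itv /= => h; apply/andP; split; nra.
have [x0 + x0max] := @compact_EVT_max _ _ (fun x => dot x (M *m x)) _ sph0 csph
  (continuous_subspaceT (@continuous_quadratic R k M)).
rewrite inE /sph /= => x01.
set mu := dot x0 (M *m x0) in x0max.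
have rayleigh h : dot h (M *m h) <= mu * dot h h.
  have [->|h0] := eqVneq h 0; first by rewrite mulmx0 !dot0r mulr0.
  have dh : 0 < dot h h.
    by rewrite lt_def dot_ge0 andbT; apply: contra_neq h0 => /dot_eq0.
  pose c := (Num.sqrt (dot h h))^-1.
  have c2 : c ^+ 2 = (dot h h)^-1 by rewrite exprVn sqr_sqrtr // ltW.
  have := x0max (c *: h); rewrite inE /sph /= -scalemxAr !dotE !mulrA -expr2 c2.
  by rewrite mulVf ?gt_eqF // => /(_ erefl); rewrite mulrC ler_pdivrMr.
exists mu; split=> //.
(* [r] is the residual of the eigenvector equation. [Q] is nonnegative and vanishes at [x0], so a
   nonzero [r] would be a direction of descent to negative values. *)
pose r := mu *: x0 - M *m x0.
pose Q x := mu * dot x x - dot x (M *m x).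
have symdot x y : dot x (M *m y) = dot y (M *m x).
  by rewrite -dot_mulmx symM dotC.
have Qt t : Q (x0 - t *: r) = - 2 * t * dot r r + t ^+ 2 * Q r.
  rewrite /Q mulmxBr -scalemxAr.
  have rE : dot r (M *m x0) = mu * dot x0 r - dot r r.
    by rewrite [dot r r]dotDl dotZl dotNl [dot r (M *m x0)]dotC; ring.
  clearbody r.
  by rewrite !dotE x01 (dotC r x0) (symdot x0 r) rE -/mu; ring.
have Q0 x : 0 <= Q x by rewrite subr_ge0.
have r0 : r = 0.
  apply: dot_eq0; apply/eqP; rewrite eq_le dot_ge0 andbT leNgt; apply/negP => rr.
  (* The step [t = D / (Q r + 1)] gives [t * Q r < D], so [Q (x0 - t *: r)] would be below
     [- t * D]. *)
  have Q1 : 0 < Q r + 1 by rewrite ltr_wpDl.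
  have := Q0 (x0 - (dot r r / (Q r + 1)) *: r); rewrite Qt.
  set D := dot r r in rr *; set t := D / _.
  have t0 : 0 < t by rewrite divr_gt0.
  have : t * (Q r + 1) = D by rewrite /t divfK // gt_eqF.
  by move: (Q r) (Q0 r) => q q0; nra.
apply/eigenvalueP; exists x0^T.
  rewrite -symM -trmx_mul; move/subr0_eq: r0 => <-.
  by rewrite linearZ.
by apply: contra_eq_neq x01 => /(congr1 trmx); rewrite trmxK trmx0 => ->;
  rewrite dot0r eq_sym oner_eq0.
Qed.

Lemma lambda_max_ge (M : 'M[R]_k) h : M^T = M ->
  dot h (M *m h) <= lambda_max M * dot h h.
Proof.
move=> symM; have [k0|k0] := posnP k.
  suff -> : h = 0 by rewrite mulmx0 !dot0r mulr0.
  by apply/matrixP => -[j jk]; exfalso; move: jk; rewrite k0.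
have [mu [mu_eig muM]] := rayleigh_max k0 symM.
apply: (le_trans (muM h)); apply: ler_wpM2r; first exact: dot_ge0.
(* Testing [muM] on an eigenvector bounds every eigenvalue by [mu], so the [sup] defining
   [lambda_max] is a genuine supremum. *)
apply: ub_le_sup => //; exists mu => a /= /eigenvalueP[v va v0].
have vv : 0 < dot v^T v^T.
  rewrite lt_def dot_ge0 andbT; apply: contra_neq v0 => /dot_eq0.
  by move/(congr1 trmx); rewrite trmxK trmx0.
have := muM v^T; rewrite -{1}symM -trmx_mul va linearZ /= dotZr.
by rewrite ler_pM2r.
Qed.

End lambda_max.

Section gram.
Context {R : realType} {d m : nat}.
Variable A : 'M[R]_(d, m).

Lemma lambda_max_gram_ge h :
  dot (A *m h) (A *m h) <= lambda_max (A^T *m A) * dot h h.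
Proof.
rewrite -dot_mulmx dotC mulmxA; apply: lambda_max_ge.
by rewrite trmx_mul trmxK.
Qed.

(** A basis vector selecting a nonzero column has a nonzero image. *)
Lemma lambda_max_gram_gt0 : A != 0 -> 0 < lambda_max (A^T *m A).
Proof.
case/matrix0Pn => i [j Aij].
have := lambda_max_gram_ge (delta_mx j ord0).
rewrite (dot_delta (delta_mx _ _)) mxE !eqxx mulr1; apply: lt_le_trans.
apply: lt_le_trans (sqr_coord_le _ i).
by rewrite -colE mxE lt_def sqr_ge0 andbT sqrf_eq0.
Qed.

End gram.

(** * Product sampling *)

Section product_sampling.
Context {R : realType} {n tau : nat}.
Variable X : 'I_tau -> {set 'I_n}.
Hypothesis X_partition : is_partition X.

Let choices := [set f : {ffun 'I_tau -> 'I_n} | f \in family X]%SET.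

Let card_choices : #|choices| = (\prod_k #|X k|)%N.
Proof.
rewrite cardsE card_family foldrE big_map big_enum /=.
exact: eq_bigl.
Qed.

Let card_choices_gt0 : (0 < #|choices|)%N.
Proof.
rewrite card_choices; apply: prodn_gt0 => k.
by rewrite card_gt0; case: X_partition.
Qed.

Lemma product_samplingE (B : {set 'I_n}) : product_sampling X B =
  #|[set f in choices | [set f k | k : 'I_tau] == B]|%:R / #|choices|%:R :> R.
Proof.
rewrite /product_sampling; congr (_%:R / _%:R); last by rewrite cardsE.
by congr #|pred_of_set _|; apply/setP => f; rewrite !inE.
Qed.

Lemma product_sampling_neq0 (B : {set 'I_n}) :
  product_sampling X B != 0 :> R ->
  exists2 f : {ffun 'I_tau -> 'I_n}, f \in family X &
    B = [set f k | k : 'I_tau]%SET.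
Proof.
rewrite product_samplingE mulf_eq0 negb_or => /andP[+ _].
rewrite pnatr_eq0 -lt0n => /card_gt0P[f]; rewrite !inE => /andP[fX /eqP <-].
by exists f.
Qed.

Lemma product_sampling_ge0 (B : {set 'I_n}) : 0 <= product_sampling X B :> R.
Proof. by rewrite product_samplingE divr_ge0. Qed.

(** Grouping choice functions by their image turns the probability of an event into a count of
    choice functions. *)
Lemma sum_product_sampling (P : pred {set 'I_n}) :
  \sum_(B | P B) product_sampling X B =
  #|[set f in choices | P [set f k | k : 'I_tau]%SET]|%:R / #|choices|%:R :> R.
Proof.
under eq_bigr do rewrite product_samplingE.
rewrite -mulr_suml -natr_sum; congr (_%:R / _).
rewrite -sum1_card.
rewrite (partition_big (fun f : {ffun 'I_tau -> 'I_n} =>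
  [set f k | k : 'I_tau]%SET) P) /=; last by move=> f; rewrite inE => /andP[].
apply: eq_bigr => B PB; rewrite -sum1_card; apply: eq_bigl => f.
by rewrite !inE -andbA; congr (_ && _); case: eqP => [->|_]; rewrite ?PB ?andbF.
Qed.

Lemma product_sampling_sum1 : \sum_B product_sampling X B = 1 :> R.
Proof.
rewrite sum_product_sampling (_ : [set f in _ | _] = choices)%SET.
  by rewrite divff // pnatr_eq0 -lt0n.
by apply/setP => f; rewrite !inE andbT.
Qed.

Lemma mem_family_image (f : {ffun 'I_tau -> 'I_n}) k i :
  f \in family X -> i \in X k ->
  (i \in [set f k | k : 'I_tau]%SET) = (f k == i).
Proof.
case: X_partition => _ disj _ /familyP fX iX.
apply/imsetP/eqP => [[l _ il]|<-]; last by exists k.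
have [->//|/disj /setP /(_ i)] := eqVneq k l.
by rewrite !inE iX il fX.
Qed.

(** Forcing the choice in block [k] to be [i] replaces that block by a singleton (the family [Y])
    and leaves the others free. *)
Lemma inclusion_prob_product i k : i \in X k ->
  inclusion_prob (product_sampling X) i = #|X k|%:R^-1 :> R.
Proof.
move=> iX; rewrite /inclusion_prob sum_product_sampling.
set C := [set f in _ | _]%SET.
have Xk0 : (0 < #|X k|)%N by apply/card_gt0P; exists i.
have cardC : #|choices| = (#|X k| * #|C|)%N.
  pose Y l := if l == k then [set i]%SET else X l.
  have -> : C = [set f : {ffun 'I_tau -> 'I_n} | f \in family Y]%SET.
    apply/setP => f; rewrite !inE; apply/andP/familyP => [[fX fi] l|fY].
      rewrite (mem_family_image fX iX) in fi; rewrite /Y.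
      case: (eqVneq l k) => [->|_]; first by rewrite inE.
      by move/familyP: fX.
    have fX : f \in family X.
      apply/familyP => l; have := fY l; rewrite /Y.
      by case: (eqVneq l k) => [->|//]; rewrite inE => /eqP ->.
    split=> //; rewrite (mem_family_image fX iX).
    by have := fY k; rewrite /Y eqxx inE.
  rewrite card_choices cardsE card_family foldrE big_map big_enum /=.
  rewrite (bigD1 k) //= [in RHS](bigD1 k) //= /Y eqxx cards1 mul1n.
  by congr (_ * _)%N; apply: eq_bigr => l /negPf ->.
have := card_choices_gt0; rewrite cardC muln_gt0 => /andP[_ C0].
by rewrite natrM invfM mulrCA divff ?mulr1 // pnatr_eq0 -lt0n.
Qed.

End product_sampling.

Section separable.
Context {R : realType} {n m d tau : nat}.
Variables (A : 'I_n -> 'M[R]_(d, m)) (X : 'I_tau -> {set 'I_n}).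

Lemma dot_sum_orthogonal {k : nat} (B : {set 'I_n}) (F : 'I_n -> 'cV[R]_k) :
  {in B &, forall i j, i != j -> dot (F i) (F j) = 0} ->
  dot (\sum_(i in B) F i) (\sum_(i in B) F i) = \sum_(i in B) dot (F i) (F i).
Proof.
move=> orth; rewrite dot_sumr; apply: eq_bigr => i iB.
rewrite dotC dot_sumr (bigD1 i) //= big1 ?addr0 // => j /andP[jB ji].
by rewrite orth // eq_sym.
Qed.

(* The expected separable overapproximation holds surely, not only in mean:
   distinct sampled blocks have disjoint row supports. *)
Lemma separable_overapproximation (B : {set 'I_n}) (h : 'I_n -> 'cV[R]_m) :
  group_separable A X -> product_sampling X B != 0 :> R ->
  dot (\sum_(i in B) A i *m h i) (\sum_(i in B) A i *m h i) <=
  \sum_(i in B) lambda_max ((A i)^T *m A i) * dot (h i) (h i).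
Proof.
move=> sepA /product_sampling_neq0[f /familyP fX ->].
rewrite dot_sum_orthogonal.
  by apply: ler_sum => i _; exact: lambda_max_gram_ge.
move=> _ _ /imsetP[k _ ->] /imsetP[l _ ->] kl.
have {}kl : k != l by apply: contra_neq kl => ->.
rewrite /dot big1 // => j _; apply/eqP; rewrite mulf_eq0.
have row0 i : row j (A i) = 0 -> (A i *m h i) j ord0 == 0.
  move=> r0; have -> : (A i *m h i) j ord0 = (row j (A i) *m h i) ord0 ord0.
    by rewrite -row_mul [RHS]mxE.
  by rewrite r0 mul0mx mxE.
have [r0|rk] := eqVneq (row j (A (f k))) 0; first by rewrite row0.
have [r0|rl] := eqVneq (row j (A (f l))) 0; first by rewrite (row0 (f l)) ?orbT.
by exfalso; apply: (sepA j); exists k, l, (f k), (f l); split=> //; exact: fX.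
Qed.

End separable.

(** * Histories of draws *)

(** The integrand is a finite combination of indicators of measurable events. *)
Lemma integral_finite_valued {R : realType} (dsp : measure_display)
    (Omega : measurableType dsp) (Pr : probability Omega R) (I : finType)
    (Y : Omega -> I) (mass F : I -> R) :
  (forall y, measurable [set o | Y o = y]) ->
  (forall y, Pr [set o | Y o = y] = (mass y)%:E) ->
  (\int[Pr]_o (F (Y o))%:E = (\sum_y mass y * F y)%:E)%E.
Proof.
move=> mY PrY.
have -> : (fun o => (F (Y o))%:E) =
    (fun o => \sum_(y : I) (F y)%:E * (\1_[set o' | Y o' = y] o)%:E)%E.
  apply/funext => o; rewrite (bigD1 (Y o)) //= big1 ?adde0.
    by rewrite indicE mem_set // mule1.
  by move=> y yo; rewrite indicE memNset ?mule0 //= => /esym/eqP; apply/negP.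
have int1 y : Pr.-integrable setT (EFin \o \1_[set o | Y o = y]).
  by apply: integrable_indic => //; rewrite PrY ltry.
rewrite (integral_sum measurableT) => [|y]; last first.
  by apply: (integrableZl measurableT); exact: int1.
rewrite -sumEFin; apply: eq_bigr => y _.
rewrite (integralZl measurableT (int1 y)) /= integral_indic // ?setIT.
by rewrite mulrC EFinM; congr (_ * _)%E; exact: PrY.
Qed.

Section history.
Context {R : realType} {n : nat}.

(** Draws 1 to [t] packed in a finite type, the last one outermost: expectations become finite sums
    and induction peels off the last draw. *)
Fixpoint history (t : nat) : finType :=
  if t is s.+1 then (history s * {set 'I_n})%type else unit.

Fixpoint history_of {Omega : Type} (S : nat -> Omega -> {set 'I_n})
    (t : nat) (o : Omega) : history t :=
  if t is s.+1 then (history_of S s o, S s.+1 o) else tt.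

Fixpoint history_mass (law : {set 'I_n} -> R) (t : nat) : history t -> R :=
  if t is s.+1 then fun h => history_mass law h.1 * law h.2 else fun=> 1.

(** Matches histories with the form in which [iid_draws] states the past. *)
Lemma history_ofP {Omega : Type} (S : nat -> Omega -> {set 'I_n}) t o o' :
  history_of S t o = history_of S t o' <->
  forall s, (0 < s < t.+1)%N -> S s o = S s o'.
Proof.
elim: t => [|t IH] /=; first by split=> // _ [|s].
split=> [[/IH h St] s /andP[s0]|h].
  by rewrite ltnS leq_eqVlt => /predU1P[->//|st]; apply: h; rewrite s0.
congr pair; last by apply: h; rewrite /= ltnSn.
by apply/IH => s /andP[s0 st]; apply: h; rewrite s0 (ltn_trans st).
Qed.

Variables (dsp : measure_display) (Omega : measurableType dsp)
  (Pr : probability Omega R) (law : {set 'I_n} -> R)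
  (S : nat -> Omega -> {set 'I_n}).
Hypothesis S_draws : iid_draws Pr law S.

Lemma history_draws t h :
  measurable [set o | history_of S t o = h] /\
  Pr [set o | history_of S t o = h] = (history_mass law h)%:E.
Proof.
have [mS PrS indep] := S_draws.
elim: t h => [[]|t IH [h B]] /=.
  rewrite (_ : [set _ | _] = setT) ?probability_setT //.
  by apply/seteqP; split.
have -> : [set o | (history_of S t o, S t.+1 o) = (h, B)] =
    [set o | S t.+1 o = B] `&` [set o | history_of S t o = h].
  by apply/seteqP; split=> o /= [-> ->].
have [mh Prh] := IH h.
split; first by apply: measurableI => //; exact: mS.
(* Independence is stated for a past given by a sequence of sets, which an outcome [e] realizing [h]
   supplies. Without such an outcome the event is empty and its mass is 0 by induction. *)
have [[e he]|hno] := pselect (exists o, history_of S t o = h); last first.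
  have h0 : [set o | history_of S t o = h] = set0.
    by apply/seteqP; split=> // o ho; apply: hno; exists o.
  move: Prh; rewrite h0 setI0 measure0 => -[<-].
  by rewrite mul0r.
have := indep t.+1 (fun s => if s == t.+1 then B else S s e) erefl.
rewrite /= eqxx.
have -> : [set o | forall s, (0 < s < t.+1)%N ->
    S s o = (if s == t.+1 then B else S s e)] =
    [set o | history_of S t o = h].
  rewrite -he; apply/seteqP; split=> o /=.
    move=> ho; apply/history_ofP => s st; rewrite ho // ltn_eqF //.
    by case/andP: st.
  move=> /history_ofP ho s st; rewrite ho // ltn_eqF //.
  by case/andP: st.
by move=> ->; rewrite PrS // Prh -EFinM mulrC.
Qed.

End history.

(** * Convergence of Quartz *)

Section quartz_theory.
Context {R : realType} {n m d : nat}.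
Variables (phi : 'I_n -> 'cV[R]_m -> R) (g : 'cV[R]_d -> R).
Variables (A : 'I_n -> 'M[R]_(d, m)) (lam gam : R).
Hypotheses (n_gt0 : (0 < n)%N) (gam_gt0 : 0 < gam) (lam_gt0 : 0 < lam).
Hypothesis phi_convex : forall i, is_convex (phi i).
Hypothesis phi_differentiable : forall i x, differentiable (phi i) x.
Hypothesis phi_smooth : forall i, gradient_lipschitz gam^-1 (phi i).
Hypothesis g_strongly_convex : strongly_convex1 g.

Let n0 : 0 < n%:R :> R. Proof. by rewrite ltr0n. Qed.

Definition dual_feasible (alpha : 'I_n -> 'cV[R]_m) : Prop :=
  forall i, conjugate (phi i) (- alpha i) \is a fin_num.

(** Faithful only on feasible points, as [fine] sends infinite conjugates to 0. *)
Definition real_gap (w : 'cV[R]_d) (alpha : 'I_n -> 'cV[R]_m) : R :=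
  primal phi g A lam w + lam * fine (conjugate g (dual_average A lam alpha))
  + n%:R^-1 * \sum_i fine (conjugate (phi i) (- alpha i)).

Lemma duality_gapE w alpha : dual_feasible alpha ->
  duality_gap phi g A lam w alpha = (real_gap w alpha)%:E.
Proof.
move=> fin; rewrite /duality_gap /dual.
have -> : (\sum_(i < n) conjugate (phi i) (- alpha i) =
    (\sum_i fine (conjugate (phi i) (- alpha i)))%:E)%E.
  by rewrite -sumEFin; apply: eq_bigr => i _; rewrite fineK.
rewrite (conjugate_eq _ g_strongly_convex) /real_gap.
rewrite (conjugate_eq _ g_strongly_convex) /=.
by rewrite -EFinD; congr _%:E; ring.
Qed.

(** No conjugate takes the value [-oo], so a single infinite one makes the sum, and with it the gap,
    [+oo]. *)
Lemma dual_feasible_gap w alpha :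
  (duality_gap phi g A lam w alpha < +oo)%E -> dual_feasible alpha.
Proof.
move=> gap i; rewrite fin_real // conjugate_gtNy /= ltey; apply/eqP => iy.
move: gap; rewrite /duality_gap /dual.
have -> : (\sum_(i < n) conjugate (phi i) (- alpha i) = +oo)%E.
  apply/eqP; rewrite esum_eqy; last by move=> j _; rewrite gt_eqF ?conjugate_gtNy.
  by apply/existsP; exists i; rewrite iy.
by rewrite (conjugate_eq _ g_strongly_convex) gt0_muley ?lte_fin ?invr_gt0.
Qed.

(** * The step size and the bounds on one increment *)

Section step.
Variables (p v : 'I_n -> R).
Let theta := quartz_theta lam gam p v.
Hypothesis v_ge0 : forall i, 0 <= v i.
Hypothesis p_gt0 : forall i, 0 < p i.

Let denom_gt0 i : 0 < v i + lam * gam * n%:R.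
Proof. by rewrite ltr_wpDl // !mulr_gt0. Qed.

Lemma quartz_theta_le i :
  theta <= p i * lam * gam * n%:R / (v i + lam * gam * n%:R).
Proof.
apply: ge_inf; last by exists i.
exists 0 => _ [j _ <-]; rewrite divr_ge0 ?(ltW (denom_gt0 j)) //.
by rewrite !mulr_ge0 // ltW.
Qed.

Lemma quartz_theta_eq :
  exists i, theta = p i * lam * gam * n%:R / (v i + lam * gam * n%:R).
Proof.
set F := fun i => p i * lam * gam * n%:R / (v i + lam * gam * n%:R).
have [i _ iF] := arg_minP F (erefl true : xpredT (Ordinal n_gt0)).
exists i; apply/eqP; rewrite eq_le quartz_theta_le /=.
by apply: lb_le_inf; [exists (F i), i|move=> _ [j _ <-]; exact: iF].
Qed.

Lemma quartz_theta_gt0 : 0 < theta.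
Proof.
by have [i ->] := quartz_theta_eq; rewrite divr_gt0 // !mulr_gt0.
Qed.

(** The ratio is the weight of the convex combination made by Option II; the second bound makes
    strong convexity of the conjugate dominate the term in [v i]. *)
Let q_bounds i : 0 <= theta / p i <= 1 /\
  (theta / p i) * (v i + lam * gam * n%:R) <= lam * gam * n%:R.
Proof.
have h : (theta / p i) * (v i + lam * gam * n%:R) <= lam * gam * n%:R.
  have := quartz_theta_le i; rewrite ler_pdivlMr // => h.
  by rewrite mulrAC ler_pdivrMr //; apply: (le_trans h); rewrite le_eqVlt;
    apply/orP; left; apply/eqP; ring.
split=> //; apply/andP; split.
  by rewrite divr_ge0 ?ltW ?quartz_theta_gt0.
have c0 : 0 < lam * gam * n%:R by rewrite !mulr_gt0.
have := v_ge0 i; have := quartz_theta_gt0; have := p_gt0 i.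
move: h; set q := theta / p i => h p0 t0 v0.
have q0 : 0 < q by rewrite divr_gt0.
rewrite -(ler_pM2r c0) mul1r; apply: le_trans h.
by rewrite ler_wpM2l ?(ltW q0) // lerDr.
Qed.

Lemma option1_objectiveE i a abar D :
  conjugate (phi i) (- (a + D)) \is a fin_num ->
  option1_objective phi g A lam v i a abar D =
  (- (fine (conjugate (phi i) (- (a + D)))
      + dot (conjugate_gradient g abar) (A i *m D)
      + v i / (2 * lam * n%:R) * dot D D))%:E.
Proof.
move=> fD; rewrite /option1_objective -(fineK fD) /=.
by congr _%:E; rewrite enorm_sqr; ring.
Qed.

(* For Option I, compare with the increment of Option II. *)
Lemma increment_bound opt i a abar w Delta :
  conjugate (phi i) (- a) \is a fin_num ->
  quartz_increment phi g A lam gam p v opt i a abar w Delta ->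
  let z := conjugate_gradient g abar in
  let x := (A i)^T *m w in
  let G := gradient (phi i) x in
  conjugate (phi i) (- (a + Delta)) \is a fin_num /\
  fine (conjugate (phi i) (- (a + Delta))) + dot z (A i *m Delta)
    + v i / (2 * lam * n%:R) * dot Delta Delta <=
  (1 - theta / p i) * fine (conjugate (phi i) (- a))
    + theta / p i * (dot x G - phi i x)
    - theta / p i * dot z (A i *m (a + G)).
Proof.
move=> fa incr z x G.
have [q01 qv] := q_bounds i; move: incr; rewrite /quartz_increment -/theta -/x -/G.
set q := theta / p i in q01 qv *.
(* The Option II increment moves [- a] to a convex combination of [- a] and [G], where strong
   convexity of the conjugate applies. *)
pose D2 := - q *: a - q *: G.
have fG : conjugate (phi i) G \is a fin_num.
  by rewrite (conjugate_gradientE (@phi_differentiable i)).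
have aD2 : - (a + D2) = (1 - q) *: (- a) + q *: G.
  apply/matrixP => j k; rewrite !mxE; ring.
have D2E : D2 = - q *: (a + G).
  by rewrite /D2 scalerDr !scaleNr.
have := conjugate_strongly_convex gam_gt0 (@phi_differentiable i)
  (@phi_smooth i) q01 fa fG.
rewrite -aD2 (conjugate_gradientE (@phi_differentiable i)) //= => cD2.
have fD2 := conjugate_fin_num cD2.
rewrite -(fineK fD2) lee_fin in cD2.
have bound2 : fine (conjugate (phi i) (- (a + D2))) + dot z (A i *m D2)
    + v i / (2 * lam * n%:R) * dot D2 D2 <=
  (1 - q) * fine (conjugate (phi i) (- a)) + q * (dot x G - phi i x)
    - q * dot z (A i *m (a + G)).
  have dD2 : dot D2 D2 = q ^+ 2 * dot (a + G) (a + G).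
    by rewrite D2E dotZl dotZr; ring.
  have -> : dot z (A i *m D2) = - q * dot z (A i *m (a + G)).
    by rewrite D2E -scalemxAr dotZr.
  have {}cD2 : fine (conjugate (phi i) (- (a + D2))) <=
      (1 - q) * fine (conjugate (phi i) (- a)) + q * (dot x G - phi i x)
      - gam / 2 * (q * (1 - q)) * dot (a + G) (a + G).
    apply: (le_trans cD2); rewrite le_eqVlt; apply/orP; left; apply/eqP.
    congr (_ - _ * _); rewrite -opprD dotNl dotNr opprK //.
  (* Both sides are multiples of [dot (a + G) (a + G)]. Up to a common factor [q], the coefficients
     compare by [q * v i <= lam * gam * n%:R * (1 - q)], which is [qv]. *)
  suff : v i / (2 * lam * n%:R) * dot D2 D2 <=
      gam / 2 * (q * (1 - q)) * dot (a + G) (a + G) by lra.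
  rewrite dD2 mulrA ler_wpM2r ?dot_ge0 //.
  rewrite mulrAC ler_pdivrMr ?mulr_gt0 //.
  have -> : gam / 2 * (q * (1 - q)) * (2 * lam * n%:R) =
     q * (lam * gam * n%:R - q * (lam * gam * n%:R)) by field.
  rewrite expr2 mulrCA; case/andP: q01 => q0 _; apply: ler_wpM2l => //; lra.
case: opt => [opt1|->]; last by [].
have := opt1 D2; rewrite (option1_objectiveE abar fD2) => le1.
(* An infinite conjugate would give [Delta] the objective [-oo], below the real value at [D2]. *)
have fD : conjugate (phi i) (- (a + Delta)) \is a fin_num.
  rewrite fin_real // conjugate_gtNy ltey; apply/eqP => yD.
  by move: le1; rewrite /option1_objective yD.
split=> //; apply: le_trans bound2.
by move: le1; rewrite (option1_objectiveE abar fD) lee_fin lerN2.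
Qed.

(* The objective of Option I is strictly concave. *)
Lemma increment_unique opt i a abar w D1 D2 :
  conjugate (phi i) (- a) \is a fin_num ->
  quartz_increment phi g A lam gam p v opt i a abar w D1 ->
  quartz_increment phi g A lam gam p v opt i a abar w D2 ->
  D1 = D2.
Proof.
move=> fa incr1 incr2.
have [f1 _] := increment_bound fa incr1.
have [f2 _] := increment_bound fa incr2.
case: opt incr1 incr2 => /= [opt1 opt2|-> -> //].
(* Strong convexity at the midpoint would beat two distinct maximizers. *)
pose D3 := 2^-1 *: (D1 + D2).
have half01 : 0 <= (2^-1 : R) <= 1 by apply/andP; split; lra.
have := conjugate_strongly_convex gam_gt0 (@phi_differentiable i)
  (@phi_smooth i) half01 f1 f2.
have -> : (1 - 2^-1) *: - (a + D1) + 2^-1 *: - (a + D2) = - (a + D3).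
  by apply/matrixP => j k; rewrite !mxE; field.
have -> : - (a + D1) - - (a + D2) = D2 - D1.
  by apply/matrixP => j k; rewrite !mxE; ring.
move=> c3; have f3 := conjugate_fin_num c3.
rewrite -(fineK f3) lee_fin in c3.
have := opt1 D3; have := opt1 D2; have := opt2 D1.
rewrite !option1_objectiveE // !lee_fin !lerN2 => le12 le21 le13.
have lin : dot (conjugate_gradient g abar) (A i *m D3) =
    2^-1 * (dot (conjugate_gradient g abar) (A i *m D1)
            + dot (conjugate_gradient g abar) (A i *m D2)).
  by rewrite -scalemxAr dotZr mulmxDr dotDr.
have quad : v i / (2 * lam * n%:R) * dot D3 D3 <= v i / (2 * lam * n%:R) *
    (2^-1 * dot D1 D1 + 2^-1 * dot D2 D2).
  apply: ler_wpM2l; first by rewrite divr_ge0 // !mulr_ge0 // ltW.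
  by have := dot_ge0 (D1 - D2); rewrite /D3 !dotE (dotC D2 D1); lra.
have : gam * dot (D2 - D1) (D2 - D1) <= 0 by lra.
rewrite pmulr_rle0 // => dle0; apply/eqP; rewrite eq_sym -subr_eq0.
by apply/eqP/dot_eq0/eqP; rewrite eq_le dle0 dot_ge0.
Qed.

Lemma step_feasible opt alpha abar w (B : {set 'I_n}) Delta alpha' :
  dual_feasible alpha ->
  (forall i, i \in B ->
     quartz_increment phi g A lam gam p v opt i (alpha i) abar w (Delta i)) ->
  (forall i, alpha' i = if i \in B then alpha i + Delta i else alpha i) ->
  dual_feasible alpha'.
Proof.
move=> fin incr upd i; rewrite upd; case: ifPn => // iB.
by have [] := increment_bound (fin i) (incr i iB).
Qed.

Lemma dual_average_update (alpha alpha' Delta : 'I_n -> 'cV[R]_m)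
    (B : {set 'I_n}) :
  (forall i, alpha' i = if i \in B then alpha i + Delta i else alpha i) ->
  dual_average A lam alpha' = dual_average A lam alpha +
    (lam * n%:R)^-1 *: \sum_(i in B) A i *m Delta i.
Proof.
move=> upd.
rewrite /dual_average -scalerDr [\sum_(i in B) _]big_mkcond -big_split /=.
congr (_ *: _); apply: eq_bigr => i _; rewrite upd.
by case: ifP; rewrite ?mulmxDr // addr0.
Qed.

(** * Expected decrease of the gap in one iteration *)

Section expectation.
Variable law : {set 'I_n} -> R.
Hypothesis law_ge0 : forall B, 0 <= law B.
Hypothesis law_sum1 : \sum_(B : {set 'I_n}) law B = 1.
Hypothesis law_incl : forall i, inclusion_prob law i = p i.
Hypothesis law_eso : forall B (h : 'I_n -> 'cV[R]_m), law B != 0 ->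
  dot (\sum_(i in B) A i *m h i) (\sum_(i in B) A i *m h i)
  <= \sum_(i in B) v i * dot (h i) (h i).

Lemma law_sum_coord (b c : 'I_n -> R) :
  \sum_(B : {set 'I_n}) law B * \sum_i (if i \in B then b i else c i) =
  \sum_i (c i + p i * (b i - c i)).
Proof.
under eq_bigr do rewrite big_distrr /=.
rewrite exchange_big; apply: eq_bigr => i _.
have -> : \sum_(B : {set 'I_n}) law B * (if i \in B then b i else c i) =
    \sum_(B : {set 'I_n}) law B * c i +
    \sum_(B : {set 'I_n}) (if i \in B then law B * (b i - c i) else 0).
  by rewrite -big_split; apply: eq_bigr => B _ /=; case: ifP => _; ring.
by rewrite -mulr_suml law_sum1 mul1r -big_mkcond -mulr_suml -(law_incl i).
Qed.

(** [theta] is at most each [p i], which is a probability. *)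
Lemma quartz_theta_le1 : theta <= 1.
Proof.
have [/andP[_]] := q_bounds (Ordinal n_gt0).
rewrite ler_pdivrMr // mul1r => /le_trans + _; apply.
rewrite -law_incl -law_sum1 /inclusion_prob big_mkcond.
by apply: ler_sum => B _; case: ifP.
Qed.

Section one_step.
Variables (opt : quartz_option) (w : 'cV[R]_d) (alpha : 'I_n -> 'cV[R]_m).
Hypothesis alpha_feasible : dual_feasible alpha.
Let abar := dual_average A lam alpha.
Let z := conjugate_gradient g abar.
Let w1 := (1 - theta) *: w + theta *: z.
Let c i := fine (conjugate (phi i) (- alpha i)).
Let x i := (A i)^T *m w1.
Let G i := gradient (phi i) (x i).
(** The bound of [increment_bound] on the contribution of a sampled coordinate; an unsampled one
    contributes [c i]. *)
Let b i := (1 - theta / p i) * c i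
    + theta / p i * (dot (x i) (G i) - phi i (x i))
    - theta / p i * dot z (A i *m (alpha i + G i)).

(** Smoothness of the conjugate of [g] expands the new dual average, and [law_eso] splits the
    quadratic term over the sampled coordinates, so that [increment_bound] applies to each one. *)
Lemma real_gap_step (B : {set 'I_n}) alpha' Delta : law B != 0 ->
  (forall i, i \in B ->
     quartz_increment phi g A lam gam p v opt i (alpha i) abar w1 (Delta i)) ->
  (forall i, alpha' i = if i \in B then alpha i + Delta i else alpha i) ->
  real_gap w1 alpha' <=
  primal phi g A lam w1 + lam * fine (conjugate g abar)
    + n%:R^-1 * \sum_i (if i \in B then b i else c i).
Proof.
move=> lawB incr upd.
rewrite /real_gap (dual_average_update upd) -/abar -!addrA lerD2l.
set D := \sum_(i in B) A i *m Delta i.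
have := conjugate_smooth abar ((lam * n%:R)^-1 *: D) g_strongly_convex.
rewrite -/z !dotE => /(ler_wpM2l (ltW lam_gt0)).
have := law_eso Delta lawB; rewrite -/D => eso smooth.
have {smooth} : lam * fine (conjugate g (abar + (lam * n%:R)^-1 *: D)) <=
    lam * fine (conjugate g abar) + n%:R^-1 * \sum_(i in B)
     (dot z (A i *m Delta i) + v i / (2 * lam * n%:R) * dot (Delta i) (Delta i)).
  apply: (le_trans smooth); rewrite mulrDr mulrDr -addrA lerD2l.
  rewrite big_split mulrDr -dot_sumr -/D lerD //.
    by rewrite le_eqVlt; apply/orP; left; apply/eqP; field; rewrite !gt_eqF.
  have -> : \sum_(i in B) v i / (2 * lam * n%:R) * dot (Delta i) (Delta i) =
      (2 * lam * n%:R)^-1 * \sum_(i in B) v i * dot (Delta i) (Delta i).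
    by rewrite big_distrr; apply: eq_bigr => i _ /=; ring.
  set E := \sum_(i in B) _ in eso *.
  have -> : lam * (2^-1 * ((lam * n%:R)^-1 * ((lam * n%:R)^-1 * dot D D))) =
      n%:R^-1 * ((2 * lam * n%:R)^-1 * dot D D) by field; rewrite !gt_eqF.
  by rewrite !ler_pM2l ?invr_gt0 ?mulr_gt0.
move=> smooth; rewrite lerD2l; apply: (le_trans (lerD smooth (lexx _))).
rewrite -addrA lerD2l -mulrDr ler_pM2l ?invr_gt0 // big_mkcond -big_split /=.
apply: ler_sum => i _; rewrite upd; case: ifPn => iB; last by rewrite add0r.
have [_] := increment_bound (alpha_feasible i) (incr i iB).
by rewrite -/z -/(x i) -/(G i) -/(c i) -/(b i); lra.
Qed.

(** Averaging turns the weights [theta / p i] into the common [theta]. Convexity of each [phi i] at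
    [x i] absorbs the terms in [G i], and Fenchel equality at [z] combines [theta * g z] with the
    linear terms in [alpha]. *)
Lemma mean_bound_step :
  primal phi g A lam w1 + lam * fine (conjugate g abar)
    + n%:R^-1 * \sum_i (c i + p i * (b i - c i))
  <= (1 - theta) * real_gap w alpha.
Proof.
have t0 := quartz_theta_gt0.
have t1 := quartz_theta_le1.
have gw1 : g w1 <= (1 - theta) * g w + theta * g z.
  have := is_convex_le z w (t := theta) g_strongly_convex.1.
  rewrite t1 ltW // => /(_ isT). rewrite [theta *: z + _]addrC -/w1; lra.
have coord i : phi i (x i) + (c i + p i * (b i - c i)) <=
    (1 - theta) * (phi i ((A i)^T *m w) + c i)
    - theta * dot z (A i *m alpha i).
  have := gradient_subgradient (@phi_convex i) (@phi_differentiable i (x i))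
    ((A i)^T *m w).
  rewrite -mulmxBr.
  (* The definition of [w1] in use: scaled by [1 - theta], the convexity inequality then has a
     linear term that cancels exactly those of [b i] in [G i]. *)
  have : (1 - theta) *: (w - w1) = theta *: (w1 - z).
    by apply/matrixP => j k; rewrite !mxE; ring.
  move/(congr1 (fun y => dot (G i) ((A i)^T *m y))).
  rewrite -!scalemxAr !dotZr [in RHS]mulmxBr [in RHS]dotDr [in RHS]dotNr -/(x i).
  rewrite (dotC _ ((A i)^T *m z)) dot_mulmx -/(G i) => e1.
  have -> : p i * (b i - c i) = theta * (dot (x i) (G i) - phi i (x i) - c i
      - dot z (A i *m alpha i) - dot z (A i *m G i)).
    by rewrite /b mulmxDr dotDr; field; rewrite gt_eqF.
  move/(ler_wpM2l (_ : 0 <= 1 - theta)); rewrite subr_ge0 => /(_ t1).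
  rewrite mulrDr e1 (dotC (G i)); lra.
rewrite /real_gap /primal -/abar.
rewrite (conjugate_eq _ g_strongly_convex) /= -/z.
have sumz : n%:R^-1 * \sum_i dot z (A i *m alpha i) = lam * dot z abar.
  rewrite /abar /dual_average dotZr dot_sumr; field; rewrite !gt_eqF //.
have : n%:R^-1 * \sum_i (phi i (x i) + (c i + p i * (b i - c i))) <=
    (1 - theta) * (n%:R^-1 * \sum_i phi i ((A i)^T *m w)
                   + n%:R^-1 * \sum_i c i) - theta * (lam * dot z abar).
  rewrite -sumz -mulrDr -big_split mulrCA (mulrCA theta) -mulrBr.
  rewrite ler_pM2l ?invr_gt0 // !big_distrr -sumrB.
  by apply: ler_sum => i _; exact: coord.
rewrite big_split mulrDr /=.
have := ler_wpM2l (ltW lam_gt0) gw1.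
set s1 := _ * \sum_i phi i (x i); set s2 := _ * \sum_i (_ + _).
set s3 := _ * \sum_i phi _ _; set s4 := _ * \sum_i c _.
lra.
Qed.

Lemma expected_gap_step (alpha' : {set 'I_n} -> 'I_n -> 'cV[R]_m) :
  (forall B, law B != 0 -> exists Delta : 'I_n -> 'cV[R]_m,
    (forall i, i \in B ->
      quartz_increment phi g A lam gam p v opt i (alpha i) abar w1 (Delta i)) /\
    forall i, alpha' B i = if i \in B then alpha i + Delta i else alpha i) ->
  \sum_(B : {set 'I_n}) law B * real_gap w1 (alpha' B)
  <= (1 - theta) * real_gap w alpha.
Proof.
move=> step; apply: le_trans mean_bound_step.
pose K := primal phi g A lam w1 + lam * fine (conjugate g abar).
rewrite -law_sum_coord -/K.
have -> : K + n%:R^-1 * \sum_(B : {set 'I_n})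
      law B * \sum_i (if i \in B then b i else c i) =
    \sum_(B : {set 'I_n})
      law B * (K + n%:R^-1 * \sum_i (if i \in B then b i else c i)).
  under [RHS]eq_bigr do rewrite mulrDr.
  rewrite big_split -mulr_suml law_sum1 mul1r big_distrr /=; congr (_ + _).
  by apply: eq_bigr => B _; rewrite mulrCA.
apply: ler_sum => B _; have [->|lawB] := eqVneq (law B) 0; first by rewrite !mul0r.
have [Delta [incr upd]] := step B lawB.
by rewrite ler_wpM2l // (real_gap_step lawB incr upd).
Qed.

End one_step.

(** * Iteration along the random trajectory *)

Section convergence.
Variables (dsp : measure_display) (Omega : measurableType dsp)
  (Pr : probability Omega R) (S : nat -> Omega -> {set 'I_n})
  (opt : quartz_option) (w0 : 'cV[R]_d) (alpha0 : 'I_n -> 'cV[R]_m)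
  (w : nat -> Omega -> 'cV[R]_d) (alpha : nat -> Omega -> 'I_n -> 'cV[R]_m)
  (abar : nat -> Omega -> 'cV[R]_d).
Hypothesis S_draws : iid_draws Pr law S.
Hypothesis run : forall o, quartz_run phi g A lam gam p v opt w0 alpha0
  (S ^~ o) (w ^~ o) (alpha ^~ o) (abar ^~ o).
Hypothesis alpha0_feasible : dual_feasible alpha0.

Lemma run_invariant t o : dual_feasible (alpha t o) /\
  abar t o = dual_average A lam (alpha t o).
Proof.
elim: t => [|t [fin avg]].
  by rewrite (quartz_alpha0 (run o)) (quartz_abar0 (run o)).
have [Delta [incr upd avg']] := quartz_step (run o) t.
by rewrite avg' (dual_average_update upd) avg; split=> //;
  exact: step_feasible fin incr upd.
Qed.

(** Option I only characterizes the increments as maximizers; that they depend on the history alone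
    rests on [increment_unique]. *)
Lemma run_history t o o' : history_of S t o = history_of S t o' ->
  [/\ w t o = w t o', alpha t o = alpha t o' & abar t o = abar t o'].
Proof.
elim: t => [_|t IH /= [/IH[ww aa bb] SS]].
  rewrite !(quartz_w0 (run _)) !(quartz_alpha0 (run _)).
  by rewrite !(quartz_abar0 (run _)).
have ww' : w t.+1 o = w t.+1 o'.
  by rewrite (quartz_w (run o)) (quartz_w (run o')) ww bb.
have [D [incr upd avg]] := quartz_step (run o) t.
have [D' [incr' upd' avg']] := quartz_step (run o') t.
have DD i : i \in S t.+1 o -> D i = D' i.
  move=> iS; have [fin _] := run_invariant t o.
  apply: (increment_unique (fin i) (incr i iS)).
  by rewrite ww' aa bb; apply: incr'; rewrite -SS.
split=> //.
  apply/funext => i; rewrite upd upd' -SS aa.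
  by case: ifPn => // iS; rewrite DD.
by rewrite avg avg' bb -SS; congr (_ + _ *: _); apply: eq_bigr => i /DD ->.
Qed.

(* By [run_history] the choice of [o] is irrelevant; the value 0 on unrealized
   histories is harmless as they have mass 0. *)
Definition history_gap t (h : history t) : R :=
  if pselect (exists o, history_of S t o = h) is left ex
  then let o := projT1 (cid ex) in real_gap (w t o) (alpha t o) else 0.

Lemma history_gapE t o :
  history_gap (history_of S t o) = real_gap (w t o) (alpha t o).
Proof.
rewrite /history_gap; case: pselect => [ex|[]]; last by exists o.
by case: cid => o' /= /run_history[-> ->].
Qed.

Lemma history_mass_ge0 t (h : history t) : 0 <= history_mass law h.
Proof. by elim: t h => //= t IH [h B]; rewrite mulr_ge0. Qed.

Lemma history_mass_neq0 t (h : history t) :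
  history_mass law h != 0 -> exists o, history_of S t o = h.
Proof.
move=> h0; apply: contrapT => hno; move/eqP: h0; apply.
have [_] := history_draws S_draws h.
rewrite (_ : [set _ | _] = set0) ?measure0; first by case.
by apply/seteqP; split=> // o ho; apply: hno; exists o.
Qed.

(** Conditioning on the first [t] draws fixes the current iterates, and [expected_gap_step] averages
    over the next draw. *)
Lemma expected_gap_bound t :
  \sum_(h : history t) history_mass law h * history_gap h <=
  (1 - theta) ^+ t * real_gap w0 alpha0.
Proof.
have t1 : 0 <= 1 - theta by rewrite subr_ge0 quartz_theta_le1.
elim: t => [|t IH] /=.
  rewrite expr0 mul1r.
  (* The empty history has mass 1, which provides an outcome. *)
  have [|o _] := @history_mass_neq0 0 tt; first exact: oner_neq0.
  rewrite (bigD1 tt) //= big1 ?addr0 => [|[]//]; rewrite mul1r.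
  have := history_gapE 0 o; rewrite /= => ->.
  by rewrite (quartz_w0 (run o)) (quartz_alpha0 (run o)).
rewrite exprS -mulrA; apply: le_trans (ler_wpM2l t1 IH).
have -> : \sum_(h : history t * {set 'I_n}) history_mass law h.1 * law h.2 *
      history_gap (h : history t.+1) =
    \sum_(h : history t) history_mass law h *
      \sum_(B : {set 'I_n}) law B * history_gap ((h, B) : history t.+1).
  under [RHS]eq_bigr do rewrite big_distrr.
  by rewrite pair_bigA; apply: eq_bigr => -[h B] _ /=; rewrite mulrA.
rewrite big_distrr; apply: ler_sum => h _ /=; rewrite mulrCA.
have [->|h0] := eqVneq (history_mass law h) 0; first by rewrite !mul0r.
rewrite ler_wpM2l ?history_mass_ge0 //.
have [e he] := history_mass_neq0 h0.
have [fin avg] := run_invariant t e.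
(* An outcome extending [h] by each [B] of nonzero mass; for the other sets [e] is a dummy value. *)
have /choice[next nextP] B : exists e', law B != 0 ->
    history_of S t.+1 e' = (h, B).
  have [lawB|lawB] := eqVneq (law B) 0; first by exists e => /eqP.
  have [|e' he'] := @history_mass_neq0 t.+1 (h, B); first by rewrite mulf_neq0.
  by exists e'.
have nextE B : law B != 0 -> [/\ w t (next B) = w t e,
    alpha t (next B) = alpha t e, abar t (next B) = abar t e &
    S t.+1 (next B) = B].
  by move=> /nextP[hB SB]; have [|-> -> ->] := @run_history t (next B) e;
    rewrite ?hB ?he.
rewrite -he history_gapE.
have := expected_gap_step fin (opt := opt) (w := w t e)
  (alpha' := fun B => alpha t.+1 (next B)).
rewrite -avg => step.
apply: le_trans (step _).
  apply: ler_sum => B _; have [->|lawB] := eqVneq (law B) 0.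
    by rewrite !mul0r.
  have [ww aa bb SB] := nextE B lawB.
  have := history_gapE t.+1 (next B); rewrite nextP // he => ->.
  by rewrite (quartz_w (run (next B))) ww bb.
move=> B lawB; have [ww aa bb SB] := nextE B lawB.
have [D [incr upd _]] := quartz_step (run (next B)) t.
move: incr upd; rewrite (quartz_w (run (next B))) aa bb ww SB => incr upd.
by exists D.
Qed.

Lemma quartz_convergence t :
  (\int[Pr]_o duality_gap phi g A lam (w t o) (alpha t o) <=
   ((1 - theta) ^+ t * real_gap w0 alpha0)%:E)%E.
Proof.
have -> : (fun o => duality_gap phi g A lam (w t o) (alpha t o)) =
    (fun o => (history_gap (history_of S t o))%:E).
  apply/funext => o; rewrite history_gapE duality_gapE //.
  by have [] := run_invariant t o.
rewrite (@integral_finite_valued _ _ _ _ _ _ (history_mass law (t := t))).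
- by rewrite lee_fin expected_gap_bound.
- by move=> h; have [] := history_draws S_draws h.
- by move=> h; have [] := history_draws S_draws h.
Qed.

End convergence.
End expectation.
End step.
End quartz_theory.

(** * Iteration count for product sampling of group separable data *)

Theorem corollary12 (R : realType) (n m d tau : nat)
  (phi : 'I_n -> 'cV[R]_m -> R) (g : 'cV[R]_d -> R)
  (A : 'I_n -> 'M[R]_(d, m)) (lam gam : R)
  (X : 'I_tau -> {set 'I_n}) (l : 'I_n -> 'I_tau)
  (dsp : measure_display) (Omega : measurableType dsp)
  (Pr : probability Omega R) (S : nat -> Omega -> {set 'I_n})
  (opt : quartz_option)
  (w0 : 'cV[R]_d) (alpha0 : 'I_n -> 'cV[R]_m)
  (w : nat -> Omega -> 'cV[R]_d)
  (alpha : nat -> Omega -> 'I_n -> 'cV[R]_m)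
  (abar : nat -> Omega -> 'cV[R]_d)
  (eps : R) (T : nat)
  (n_gt0 : (0 < n)%N) (gam_gt0 : 0 < gam) (lam_gt0 : 0 < lam)
  (phi_convex : forall i, is_convex (phi i))
  (phi_differentiable : forall i x, differentiable (phi i) x)
  (phi_smooth : forall i, gradient_lipschitz gam^-1 (phi i))
  (g_strongly_convex : strongly_convex1 g)
  (A_neq0 : forall i, A i != 0)
  (X_partition : is_partition X)
  (X_separable : group_separable A X)
  (lP : forall i, i \in X (l i))
  (S_draws : iid_draws Pr (product_sampling X) S)
  (run : forall o,
     quartz_run phi g A lam gam
       (inclusion_prob (product_sampling X))
       (fun i => lambda_max ((A i)^T *m A i))
       opt w0 alpha0
       (fun t => S t o) (fun t => w t o) (fun t => alpha t o)
       (fun t => abar t o))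
  (eps_gt0 : 0 < eps)
  (eps_le : (eps%:E <= duality_gap phi g A lam w0 alpha0)%E)
  (T_ge : ((sup (range (fun i : 'I_n => #|X (l i)|%:R +
               lambda_max ((A i)^T *m A i) * #|X (l i)|%:R
                 / (lam * gam * n%:R))))%:E
           * lne (duality_gap phi g A lam w0 alpha0 / eps%:E)
           <= (T%:R : R)%:E)%E) :
  (\int[Pr]_o duality_gap phi g A lam (w T o) (alpha T o) <= eps%:E)%E.
Proof.
have v_gt0 i : 0 < lambda_max ((A i)^T *m A i) by exact: lambda_max_gram_gt0.
set v := fun i => lambda_max ((A i)^T *m A i) in run.
have cardX_gt0 i : 0 < #|X (l i)|%:R :> R.
  by rewrite ltr0n; apply/card_gt0P; exists i.
set p := inclusion_prob (product_sampling X) in run.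
have pE i : p i = #|X (l i)|%:R^-1.
  exact: (@inclusion_prob_product R _ _ _ X_partition _ _ (lP i)).
have p_gt0 i : 0 < p i by rewrite pE invr_gt0 cardX_gt0.
have v_ge0 i : 0 <= v i by exact: ltW (v_gt0 i).
set theta := quartz_theta lam gam p v.
have theta_gt0 : 0 < theta by exact: quartz_theta_gt0.
have n0 : 0 < n%:R :> R by rewrite ltr0n.
pose K i := #|X (l i)|%:R + v i * #|X (l i)|%:R / (lam * gam * n%:R).
have K_gt0 i : 0 < K i by rewrite addr_gt0 // divr_gt0 ?mulr_gt0 // v_gt0.
have Ksup i : K i <= sup (range K).
  apply: ub_le_sup; last by exists i.
  exists (\sum_j K j) => _ [j _ <-]; rewrite (bigD1 j) //= lerDl.
  by apply: sumr_ge0 => k _; exact: ltW.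
(* At an index attaining [theta], [p i] is the inverse block size, so [theta * K i = 1]. *)
have theta_sup : 1 <= theta * sup (range K).
  have [i ti] := quartz_theta_eq n_gt0 gam_gt0 lam_gt0 v_ge0 p_gt0.
  have <- : theta * K i = 1.
    rewrite /theta ti pE /K; field.
    by rewrite !gt_eqF // ?ltr_wpDl ?mulr_gt0.
  by rewrite ler_pM2l ?Ksup.
have sup_gt0 : 0 < sup (range K) by apply: lt_le_trans (Ksup (Ordinal n_gt0)).
(* An infinite initial gap would make the lower bound on the natural number [T] infinite. *)
have feas : dual_feasible phi alpha0.
  apply: (dual_feasible_gap n_gt0 g_strongly_convex (w := w0) (A := A) (lam := lam)).
  rewrite ltey; apply/eqP => gapy; move: T_ge.
  rewrite gapy inver gt_eqF // gt0_mulye ?lte_fin ?invr_gt0 //=.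
  by rewrite gt0_muley // lte_fin.
move: T_ge eps_le; rewrite duality_gapE // => T_ge eps_le.
set gap0 := real_gap phi g A lam w0 alpha0 in T_ge eps_le.
rewrite lee_fin in eps_le.
have gap0_gt0 : 0 < gap0 by exact: lt_le_trans eps_le.
rewrite inver gt_eqF // -EFinM lne_EFin ?divr_gt0 // -EFinM lee_fin in T_ge.
have := quartz_convergence n_gt0 gam_gt0 lam_gt0 phi_convex phi_differentiable
  phi_smooth g_strongly_convex v_ge0 p_gt0 (@product_sampling_ge0 R _ _ X)
  (@product_sampling_sum1 R _ _ _ X_partition) (fun i => erefl)
  (fun B h => @separable_overapproximation R _ _ _ _ A X B h X_separable)
  S_draws run feas T.
move/le_trans; apply; rewrite lee_fin -/theta -/gap0.
(* This sign, from [eps <= gap0], allows multiplying [theta_sup] by the logarithm. *)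
have ln_ge0 : 0 <= ln (gap0 / eps) by rewrite ln_ge0 // ler_pdivlMr // mul1r.
have lnT : ln (gap0 / eps) <= theta * T%:R.
  have := ler_wpM2l (ltW theta_gt0) T_ge; apply: le_trans.
  by rewrite mulrA ler_peMl.
have theta_le1 : theta <= 1.
  exact: (quartz_theta_le1 n_gt0 gam_gt0 lam_gt0 v_ge0 p_gt0
    (@product_sampling_ge0 R _ _ X) (@product_sampling_sum1 R _ _ _ X_partition)).
have : (1 - theta) ^+ T <= eps / gap0.
  have -> : eps / gap0 = expR (- ln (gap0 / eps)).
    by rewrite expRN lnK ?posrE ?divr_gt0 // invf_div.
  apply: (@le_trans _ _ (expR (- theta) ^+ T)).
    by rewrite lerXn2r ?nnegrE ?expR_ge0 ?subr_ge0 // expR_ge1Dx.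
  by rewrite -expRM_natr ler_expR mulNr lerN2.
by rewrite ler_pdivlMr.
Qed.
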